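(* Let $\mathcal{H}_3=\mathcal{H}_3(\mathbb{Z})$ be the Heisenberg group and let $\mathfrak{e}(n)=\exp(n)$ for $n\in\mathbb{N}$. Then $\mathcal{H}_3\in\mathcal{B}_{\mathfrak{e}}$. Moreover, for any $f\in\mathfrak{F}$ with $f\prec\sqrt[3]{n}$ (where $\sqrt[3]{n}$ denotes the function $n\mapsto\sqrt[3]{n}$ on $\mathbb{N}$), $\mathcal{H}_3\notin\mathcal{B}_f$.
   Context: All groups considered are finitely generated and infinite. $\mathbb{N}$ is the set of positive integers and $\mathbb{R}^{+}$ the set of non-negative reals. The Heisenberg group $\mathcal{H}_3(\mathbb{Z})$ is the group of all matrices $\begin{pmatrix}1&x&z\\0&1&y\\0&0&1\end{pmatrix}$ with $x,y,z\in\mathbb{Z}$ under matrix multiplication. Notation. For a finite generating set $A \subseteq G$ of a group $G$, put $S = A \cup A^{-1}$. $d_A(g_1,g_2)$ denotes the distance between $g_1,g_2\in G$ in the Cayley graph $\Gamma(G,A)$. $\pi : S^* \to G$ is the canonical map sending a word to the group element it represents. Regular relations. For a finite alphabet $\Sigma$ and a padding symbol $\diamond \notin \Sigma$, the convolution $w_1 \otimes w_2$ of $w_1,w_2\in\Sigma^*$ is the string of length $\max\{|w_1|,|w_2|\}$ over $(\Sigma\cup\{\diamond\})^2$ whose $k$th symbol is $(\sigma_1,\sigma_2)$, where $\sigma_i$ is the $k$th symbol of $w_i$ if $k \leqslant |w_i|$ and $\diamond$ otherwise. A binary relation $R \subseteq \Sigma^*\times\Sigma^*$ is regular if $\{w_1\otimes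 w_2 : (w_1,w_2)\in R\}$ is a regular language (accepted by a finite automaton over $(\Sigma\cup\{\diamond\})^2\setminus\{(\diamond,\diamond)\}$). Cayley automatic representation. A Cayley automatic representation of $G$ (with respect to $A$) is a bijection $\psi: L \to G$, where $L\subseteq S^*$ is a regular language, such that for every $a\in A$ the relation $\{(\psi^{-1}(g),\psi^{-1}(ga)) : g\in G\}\subseteq L\times L$ is regular. $G$ is Cayley automatic if it has such a representation. Functions. $\mathfrak{F}$ is the set of all functions $f:[Q,+\infty)\to\mathbb{R}^{+}$, where $[Q,+\infty)\subseteq\mathbb{N}$ is the set of all integers $\geqslant Q$ for some $Q\in\mathbb{N}$ (depending on $f$), with $f(n)\leqslant f(n+1)$ for all $n\in\mathrm{dom}\, f$. For $f,h\in\mathfrak{F}$, write $h\preceq f$ if there exist positive integers $K,M,N$ such that $[N,+\infty)\subseteq \mathrm{dom}\,h\cap\mathrm{dom}\,f$ and $h(n)\leqslant K f(Mn)$ for every integer $n\geqslant N$. Write $h\asymp f$ if $h\preceq f$ and $f\preceq h$; write $h\prec f$ if $h\preceq f$ and not $h\asymp f$. The class $\mathcal{B}_f$. For $f\in\mathfrak{F}$, $\mathcal{B}_f$ is the class of all Cayley automatic groups $G$ for which there exist (for a chosen finite generating set $A$; the property does not depend on this choice) a regular language $L\subseteq S^*$ and a Cayley automatic representation $\psi: L\to G$ such that the function $h(n)=\max\{d_A(\pi(w),\psi(w)) : w\in L,\ |w|\leqslant n\}$ (defined for all $n$ for which $L$ contains a word of length at most $n$) satisfies $h\preceq f$. *)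

(* Defs.v *)
From HB Require Import structures.
From mathcomp Require Import all_boot all_order all_algebra finmap.
From mathcomp Require Import all_classical all_reals all_analysis.
From mathcomp Require Import ring.

Set Implicit Arguments.
Unset Strict Implicit.
Unset Printing Implicit Defensive.

Import Order.TTheory GRing.Theory Num.Theory.

Local Open Scope classical_set_scope.
Local Open Scope ring_scope.

Record dfa (char : finType) := DFA {
  dfa_state : finType;
  dfa_start : dfa_state;
  dfa_final : pred dfa_state;
  dfa_trans : dfa_state -> char -> dfa_state }.

Definition dfa_accept (char : finType) (M : dfa char) (w : seq char) : bool :=
  dfa_final (foldl (@dfa_trans _ M) (dfa_start M) w).

Definition regular (char : finType) (L : set (seq char)) : Prop :=
  exists M : dfa char, L = [set w | dfa_accept M w].

(* The padding symbol is [None]; the alphabet of convolutions excludes the pair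
   of two padding symbols. *)
Definition padded (char : finType) : finType :=
  {p : option char * option char | p != (None, None)}.

(* [onth w k] is [Some] of the symbol of [w] at position [k] (counted from 0),
   and [None] past the end of [w]. *)
Definition convolution (char : finType) (w1 w2 : seq char) :
    seq (option char * option char) :=
  mkseq (fun k => (onth w1 k, onth w2 k)) (maxn (size w1) (size w2)).

Definition regular_rel (char : finType) (E : set (seq char * seq char)) : Prop :=
  regular [set u : seq (padded char) |
    exists2 w, E w & map val u = convolution w.1 w.2].

Section Cayley.
Variables (G : groupType) (A : {fset G}).

(* S = A \cup A^-1; coerced to a type, it is the finite alphabet over
   which words are written. *)
Definition symgen : {fset G} := (A `|` [fset (a^-1)%g | a in A])%fset.

Definition word_val (w : seq symgen) : G := (\prod_(s <- w) val s)%g.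

Definition generates : Prop := forall g : G, exists w : seq symgen, word_val w = g.

Definition cayley_edge : rel G := fun g1 g2 => (g1^-1 * g2)%g \in symgen.

Definition cayley_walk (g1 g2 : G) (n : nat) : Prop :=
  exists p : seq G, [/\ path cayley_edge g1 p, last g1 p = g2 & size p = n].

(* Length of a shortest walk; the default value 0 is only taken when there is
   no walk, which does not happen when A generates G. *)
Definition cayley_dist (g1 g2 : G) : nat :=
  match pselect (exists n, `[< cayley_walk g1 g2 n >]) with
  | left walk => ex_minn walk
  | right _ => 0%N
  end.

(* The map psi is defined on all words, but only its restriction to L matters;
   the relation is the set of pairs (psi^-1(g), psi^-1(g a)) for g in G. *)
Definition cayley_automatic_rep (L : set (seq symgen)) (psi : seq symgen -> G) :
    Prop :=
  [/\ regular L,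
      set_bij L [set: G] psi &
      forall a, a \in A ->
        regular_rel [set w | exists g : G,
          (L w.1 /\ psi w.1 = g) /\ (L w.2 /\ psi w.2 = (g * a)%g)]].

End Cayley.

Definition cayley_automatic (G : groupType) : Prop :=
  exists A : {fset G}, generates A /\
    exists (L : set (seq (symgen A))) (psi : seq (symgen A) -> G),
      cayley_automatic_rep L psi.

(* A partial function on the integers; [pf_val] is only meaningful on
   [pf_dom]. *)
Record pfun_nat (R : realType) := PFunNat {
  pf_dom : set nat;
  pf_val :> nat -> R }.

Section Growth.
Variable R : realType.
Implicit Types f h : pfun_nat R.

Definition growth f : Prop :=
  (exists2 Q : nat, (0 < Q)%N & pf_dom f = [set n | (Q <= n)%N]) /\
  (forall n, pf_dom f n -> 0 <= f n /\ f n <= f n.+1).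

Definition growth_le h f : Prop :=
  exists K M N : nat,
    [/\ [/\ (0 < K)%N, (0 < M)%N & (0 < N)%N],
        [set n | (N <= n)%N] `<=` pf_dom h `&` pf_dom f &
        forall n, (N <= n)%N -> h n <= K%:R * f (M * n)%N].

Definition growth_equiv h f : Prop := growth_le h f /\ growth_le f h.

Definition growth_lt h f : Prop := growth_le h f /\ ~ growth_equiv h f.

Definition exp_growth : pfun_nat R :=
  PFunNat [set n | (0 < n)%N] (fun n => expR n%:R).

Definition cbrt_growth : pfun_nat R :=
  PFunNat [set n | (0 < n)%N] (fun n => n%:R `^ (3%:R^-1)).

Lemma exp_growthP : growth exp_growth.
Proof.
split; first by exists 1%N.
by move=> n _ /=; rewrite expR_ge0 ler_expR ler_nat.
Qed.

Lemma cbrt_growthP : growth cbrt_growth.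
Proof.
split; first by exists 1%N.
move=> n _ /=; rewrite powR_ge0; split=> //.
by apply: ge0_ler_powR; rewrite ?invr_ge0 ?nnegrE ?ler0n ?ler_nat.
Qed.

(* The function h(n) = max {d_A(pi(w), psi(w)) : w in L, |w| <= n}; the big
   maximum over an empty family is 0, but it is nonempty on the domain. *)
Definition deviation (G : groupType) (A : {fset G}) (L : set (seq (symgen A)))
    (psi : seq (symgen A) -> G) : pfun_nat R :=
  PFunNat
    [set n | (0 < n)%N /\ exists2 w, L w & (size w <= n)%N]
    (fun n => (\max_(k < n.+1) \max_(w : k.-tuple (symgen A) | `[< L w >])
                 cayley_dist A (word_val w) (psi w))%N%:R).

Lemma deviationP (G : groupType) (A : {fset G}) (L : set (seq (symgen A)))
    (psi : seq (symgen A) -> G) : L !=set0 -> growth (deviation L psi).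
Proof.
case=> w0 Lw0; split; last first.
  move=> n _; rewrite ler0n; split=> //=; rewrite ler_nat.
  by rewrite [leqRHS]big_ord_recr /= leq_maxl.
have exP : exists n, (0 < n)%N && `[< exists2 w, L w & (size w <= n)%N >].
  by exists (size w0).+1 => /=; apply/asboolP; exists w0.
case: (ex_minnP exP) => Q /andP[Q0 /asboolP[w Lw wQ]] Qmin.
exists Q => //; apply/seteqP; split=> n /=.
  by case=> n0 exw; apply: Qmin; rewrite n0; apply/asboolP.
by move=> Qn; split; [exact: leq_trans Qn | exists w => //; exact: leq_trans Qn].
Qed.

(* Membership of G in the class B_f. It does not depend on the finite generating
   set A, which is therefore existentially quantified. *)
Definition in_B (f : pfun_nat R) (G : groupType) : Prop :=
  cayley_automatic G /\
  exists A : {fset G}, generates A /\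
    exists (L : set (seq (symgen A))) (psi : seq (symgen A) -> G),
      cayley_automatic_rep L psi /\ growth_le (deviation L psi) f.

End Growth.

Definition heis_mx (x y z : int) : 'M[int]_3 :=
  \matrix_(i, j)
    nth 0 (nth [::] [:: [:: 1; x; z]; [:: 0; 1; y]; [:: 0; 0; 1]] i) j.

Definition is_heis : pred 'M[int]_3 :=
  fun M => M == heis_mx (M 0 1) (M 1 2%:R) (M 0 2%:R).

Definition heisenberg := {M : 'M[int]_3 | is_heis M}.

HB.instance Definition _ := Choice.on heisenberg.

Lemma heis_mxP x y z : is_heis (heis_mx x y z).
Proof. by rewrite /is_heis !mxE. Qed.

Lemma heis_mxM x y z x' y' z' :
  heis_mx x y z *m heis_mx x' y' z' =
  heis_mx (x + x') (y + y') (z + x * y' + z').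
Proof.
apply/matrixP => i j; rewrite !mxE !big_ord_recl big_ord0 !mxE /=.
case: i => [[|[|[|i]]]] //= _; case: j => [[|[|[|j]]]] //= _; ring.
Qed.

Lemma heis_mx1 : 1%:M = heis_mx 0 0 0.
Proof.
apply/matrixP => i j; rewrite !mxE.
by case: i => [[|[|[|i]]]] //= ?; case: j => [[|[|[|j]]]] //= ?.
Qed.

Fact heis_mul_subproof (M N : heisenberg) : is_heis (val M *m val N).
Proof.
case: M N => [M /= /eqP ->] [N /= /eqP ->].
by rewrite heis_mxM heis_mxP.
Qed.

Fact heis_one_subproof : is_heis 1%:M.
Proof. by rewrite heis_mx1 heis_mxP. Qed.

Definition heis_mul (M N : heisenberg) : heisenberg :=
  Sub (val M *m val N) (heis_mul_subproof M N).

Definition heis_one : heisenberg := Sub 1%:M heis_one_subproof.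

Definition heis_inv (M : heisenberg) : heisenberg :=
  let x := val M 0 1 in let y := val M 1 2%:R in let z := val M 0 2%:R in
  Sub (heis_mx (- x) (- y) (x * y - z)) (heis_mxP _ _ _).

Fact heis_mulA : associative heis_mul.
Proof. by move=> M N P; apply: val_inj; rewrite /= mulmxA. Qed.

Fact heis_mul1 : left_id heis_one heis_mul.
Proof. by move=> M; apply: val_inj; rewrite /= mul1mx. Qed.

Fact heis_mulr1 : right_id heis_one heis_mul.
Proof. by move=> M; apply: val_inj; rewrite /= mulmx1. Qed.

Fact heis_mulV : left_inverse heis_one heis_inv heis_mul.
Proof.
case=> M hM; apply: val_inj; rewrite /= [X in _ *m X](eqP hM) heis_mxM heis_mx1.
by congr heis_mx; ring.
Qed.

Fact heis_mulrV : right_inverse heis_one heis_inv heis_mul.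
Proof.
case=> M hM; apply: val_inj; rewrite /= [X in X *m _](eqP hM) heis_mxM heis_mx1.
by congr heis_mx; ring.
Qed.

HB.instance Definition _ := isGroup.Build heisenberg
  heis_mulA heis_mul1 heis_mulr1 heis_mulV heis_mulrV.

(* Main.v *)
Require Import Defs.
From mathcomp Require Import all_boot all_order all_algebra.
From mathcomp Require Import all_classical all_reals all_analysis.
From mathcomp Require Import finmap zify ring.

(* Upper bound: encode (x, y, z) by the balanced ternary digits of its
   coordinates, read in parallel. Multiplication by a fixed generator is then
   checked by an automaton with bounded carries, and a word of length n encodes
   an element of length O(3^n).

   Lower bound: the Heisenberg group has a 2-cocycle of cubic growth, defining
   the Engel group as a central extension, whose integral over the loop
   Y^n X^n Y^(-2n) X^n Y^n X^(-2n) is of order n^3. A Cayley automatic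
   representation with deviation h fills such a loop: the words representing
   the O(n) vertices of the loop have length O(n), and the words of two
   neighbours stay at distance O(h + 1) from each other because they can be
   truncated at any time and completed to representatives of neighbours. So the
   loop is filled by O(n^2) squares of perimeter O(h + 1), over each of which
   the integral is O((h + 1)^3). Hence n^3 = O(n^2 (h + 1)^3). *)

Set Implicit Arguments.
Unset Strict Implicit.
Unset Printing Implicit Defensive.

Import Order.TTheory GRing.Theory Num.Theory.

Local Open Scope ring_scope.

(** * Regular relations *)

Section Automata.
Variable char : finType.
Implicit Types u v w : seq char.

Lemma size_convolution u v : size (convolution u v) = maxn (size u) (size v).
Proof. exact: size_mkseq. Qed.

Lemma onth_convolution u v k : (k < maxn (size u) (size v))%N ->
  onth (convolution u v) k = Some (onth u k, onth v k).
Proof.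
move=> k_lt; rewrite onthE (nth_map (None, None)) ?size_convolution //.
by rewrite nth_mkseq.
Qed.

Lemma convolution_cons a b u v :
  convolution (a :: u) (b :: v) = (Some a, Some b) :: convolution u v.
Proof.
rewrite /convolution /= maxnSS /mkseq /=; congr (_ :: _).
by rewrite (iotaDl 1 0) -map_comp.
Qed.

Lemma convolution_consl a u :
  convolution (a :: u) [::] = (Some a, None) :: convolution u [::].
Proof.
rewrite /convolution /= !maxn0 /mkseq /=; congr (_ :: _).
by rewrite (iotaDl 1 0) -map_comp; apply: eq_map => k /=; rewrite !onth0n.
Qed.

Lemma convolution_consr b v :
  convolution [::] (b :: v) = (None, Some b) :: convolution [::] v.
Proof.
rewrite /convolution /= !max0n /mkseq /=; congr (_ :: _).
by rewrite (iotaDl 1 0) -map_comp; apply: eq_map => k /=; rewrite !onth0n.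
Qed.

Lemma convolution_padded u v :
  exists U : seq (padded char), map val U = convolution u v.
Proof.
have : all (fun p => p != (None, None)) (convolution u v).
  apply/allP => p /onthP [k Hk].
  have k_lt : (k < maxn (size u) (size v))%N.
    by rewrite -size_convolution -onthTE Hk.
  move: Hk; rewrite onth_convolution // => -[<-].
  apply/eqP => -[uk vk].
  by move: k_lt; rewrite leq_max -!onthTE uk vk.
elim: (convolution u v) => [|p s IHs] /=; first by exists [::].
by case/andP => p_ok /IHs [U <-]; exists (exist _ p p_ok :: U).
Qed.

Lemma eq_take_onth u v k :
  (forall j, (j < k)%N -> onth u j = onth v j) -> take k u = take k v.
Proof.
elim: k u v => [|k IHk] [|a u] [|b v] uv //=.
- by have := uv 0%N isT.
- by have := uv 0%N isT.
have [->] := uv 0%N isT; congr (_ :: _); apply: IHk => j j_lt.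
exact: (uv j.+1).
Qed.

(* The completion only depends on the state reached after [k] symbols, and
   there are finitely many states. *)
Lemma regular_rel_completion (E : set (seq char * seq char)) :
  regular_rel E -> exists C, forall u v k, E (u, v) ->
    (k <= maxn (size u) (size v))%N -> exists u' v',
    [/\ E (u', v'), (maxn (size u') (size v') <= k + C)%N &
        forall j, (j < k)%N -> onth u' j = onth u j /\ onth v' j = onth v j].
Proof.
case=> M EM.
pose completes q r := dfa_final (foldl (@dfa_trans _ M) q r).
have ex_f q : exists r, (exists r, completes q r) -> completes q r.
  have [[r qr]|qN] := pselect (exists r, completes q r); first by exists r.
  by exists [::].
have [f f_ok] := choice ex_f.
exists (\max_q size (f q)) => u v k Euv k_le.
have [U U_eq] := convolution_padded u v.
have MU : dfa_accept M U.
  have : [set u0 | exists2 w, E w & map val u0 = convolution w.1 w.2]%classic U.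
    by exists (u, v).
  by rewrite EM.
pose q := foldl (@dfa_trans _ M) (dfa_start M) (take k U).
have fq_ok : completes q (f q).
  apply: f_ok; exists (drop k U).
  by rewrite /completes /q -foldl_cat cat_take_drop.
have : [set w | dfa_accept M w]%classic (take k U ++ f q).
  by rewrite /= /dfa_accept foldl_cat.
rewrite -EM => -[[u' v'] Eu'v' /= eq_conv].
have size_U : size U = maxn (size u) (size v).
  by rewrite -(size_map val) U_eq size_convolution.
have size_t : size (take k U) = k by rewrite size_takel // size_U.
have size_c : maxn (size u') (size v') = (k + size (f q))%N.
  by rewrite -size_convolution -eq_conv size_map size_cat size_t.
exists u', v'; split => //; first by rewrite size_c leq_add2l leq_bigmax.
move=> j j_lt.
have : onth (convolution u' v') j = onth (convolution u v) j.
  rewrite -eq_conv map_cat -U_eq onth_cat size_map size_t j_lt map_take.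
  by rewrite !onthE map_take nth_take.
rewrite !onth_convolution; last 2 first.
- exact: leq_trans k_le.
- by rewrite size_c ltn_addr.
by case.
Qed.

(** If [v] is longer than [u], cut one symbol past the end of [u] and complete. The first component
    is again [u], so by functionality the second is again [v], and completions are short. *)
Lemma regular_rel_size (E : set (seq char * seq char)) :
  regular_rel E -> (forall u v v', E (u, v) -> E (u, v') -> v = v') ->
  exists C, forall u v, E (u, v) -> (size v <= size u + C)%N.
Proof.
move=> /regular_rel_completion [C HC] E_fun; exists C.+1 => u v Euv.
have [vu|uv] := leqP (size v) (size u); first exact: leq_trans (leq_addr _ _).
have uv' : ((size u).+1 <= maxn (size u) (size v))%N.
  by rewrite leq_max uv orbT.
have [u' [v' [Eu'v' size_le u'u]]] := HC _ _ _ Euv uv'.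
(* The cut includes position [size u], where [u] is padded, so [u'] ends there as well. *)
have u_u' : u' = u.
  have [u'_end _] := u'u _ (ltnSn _).
  have size_u' : (size u' <= size u)%N by rewrite -onthNE u'_end onth_default.
  have := @eq_take_onth u' u (size u).
  rewrite take_oversize // take_size; apply => j j_lt.
  by have [] := u'u _ (ltnW j_lt).
rewrite (E_fun _ _ _ Euv (_ : E (u, v'))); last by rewrite -u_u'.
by rewrite addnS -addSn; apply: leq_trans size_le; rewrite leq_maxr.
Qed.
Lemma regular_rel_swap (E : set (seq char * seq char)) :
  regular_rel E -> regular_rel [set w | E (w.2, w.1)]%classic.
Proof.
case=> M EM.
pose sw (p : option char * option char) := (p.2, p.1).
have sw_ok (p : padded char) : sw (val p) != (None, None).
  by case: p => -[[x|] [y|]].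
pose swp (p : padded char) : padded char := Sub (sw (val p)) (sw_ok p).
pose M' := DFA (dfa_start M) (@dfa_final _ M) (fun q p => dfa_trans q (swp p)).
exists M'; have swK U : map val (map swp U) = map sw (map val U) by rewrite -!map_comp.
have accE U : dfa_accept M' U = dfa_accept M (map swp U).
  by rewrite /dfa_accept /=; elim: U (dfa_start M) => //= p U IHU q.
have conv_sw u v : convolution v u = map sw (convolution u v).
  by rewrite /convolution maxnC -map_comp.
have swsw : involutive sw by case.
apply/seteqP; split => U.
  move=> -[[u v] Evu UE]; rewrite /mkset accE.
  suff : [set w | dfa_accept M w]%classic (map swp U) by [].
  by rewrite -EM; exists (v, u); rewrite //= swK [map _ U]UE -conv_sw.
rewrite /mkset accE => acc.
have : [set w | dfa_accept M w]%classic (map swp U) by [].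
rewrite -EM => -[[u v] Euv] /=; rewrite swK => UE.
by exists (v, u); rewrite //= conv_sw -UE mapK.
Qed.
End Automata.

(** * Regular relations from automata reading convolutions *)

Section RegularFold.
Variables (char Q : finType) (q0 : Q) (fin : pred Q).
Variable tr : Q -> option char * option char -> Q.

(* The automaton also checks that a padding symbol is only followed by padding
   symbols on the same component. *)
Lemma regular_rel_fold (E : set (seq char * seq char)) :
  (forall u v, E (u, v) <-> fin (foldl tr q0 (convolution u v))) ->
  regular_rel E.
Proof.
move=> EP.
pose ok (b : bool) (o : option char) := b || (o == None).
(* The three booleans record whether each component is still running and whether no letter has
   followed a padding symbol so far. *)
pose step (q : Q * (bool * bool * bool)) (p : padded char) :=
  (tr q.1 (val p),
   ((val p).1 != None, (val p).2 != None,
    [&& q.2.2, ok q.2.1.1 (val p).1 & ok q.2.1.2 (val p).2])).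
exists (@DFA (padded char) _ (q0, (true, true, true))
  (fun q => fin q.1 && q.2.2) step).
have run U q : foldl step q U =
    (foldl tr q.1 (map val U), (foldl step q U).2).
  by elim: U q => [|p U IHU] q /=; [case: q | rewrite IHU].
have dead U q b : (foldl step (q, (b, false)) U).2.2 = false.
  elim: U q b => //= p U IHU q b; exact: IHU.
have convl U q : (foldl step (q, (true, false, true)) U).2.2 ->
    exists u, map val U = convolution u [::].
  elim: U q => [|[[[a|] [b|]] pab] U IHU] q /=; first by exists [::].
  - by rewrite dead.
  - by move=> /IHU [u uE]; exists (a :: u); rewrite convolution_consl -uE.
  - by rewrite dead.
  - by [].
have convr U q : (foldl step (q, (false, true, true)) U).2.2 ->
    exists v, map val U = convolution [::] v.
  elim: U q => [|[[[a|] [b|]] pab] U IHU] q /=; first by exists [::].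
  - by rewrite dead.
  - by rewrite dead.
  - by move=> /IHU [v vE]; exists (b :: v); rewrite convolution_consr -vE.
  - by [].
have conv U q : (foldl step (q, (true, true, true)) U).2.2 ->
    exists u v, map val U = convolution u v.
  elim: U q => [|[[[a|] [b|]] pab] U IHU] q /=; first by exists [::], [::].
  - by move=> /IHU [u [v uvE]]; exists (a :: u), (b :: v); rewrite convolution_cons -uvE.
  - by move=> /convl [u uE]; exists (a :: u), [::]; rewrite convolution_consl -uE.
  - by move=> /convr [v vE]; exists [::], (b :: v); rewrite convolution_consr -vE.
  - by [].
have conv_ok U u v q : map val U = convolution u v ->
    (foldl step (q, (true, true, true)) U).2.2.
  elim: u v U q => [|a u IHu] v U q.
    suff H b : map val U = convolution [::] v ->
      (foldl step (q, (b, true, true)) U).2.2 by exact: H.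
    elim: v U q b => [|b v IHv] [|[p p_ok] U] q c //.
    rewrite convolution_consr => -[pE UE].
    rewrite pE in p_ok *; rewrite /= /step /= /ok orbT; exact: IHv.
  case: v => [|b v]; last first.
    case: U => [|[p p_ok] U] //; rewrite convolution_cons => -[pE UE].
    rewrite pE in p_ok *; rewrite /= /step /= /ok; exact: IHu UE.
  suff H c : map val U = convolution (a :: u) [::] ->
    (foldl step (q, (true, c, true)) U).2.2 by exact: H.
  elim: {IHu} (a :: u) U q c => [|{}a {}u IHu] [|[p p_ok] U] q c //.
  rewrite convolution_consl => -[pE UE].
  rewrite pE in p_ok *; rewrite /= /step /= /ok orbT; exact: IHu.
apply/seteqP; split => U; rewrite /mkset /dfa_accept.
  case=> -[u v] /EP fin_uv /= UE.
  by rewrite run [map _ U]UE fin_uv (conv_ok _ u v).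
case/andP; rewrite run /= => fin_U /conv [u [v UE]].
by exists (u, v) => //=; apply/EP; rewrite -UE.
Qed.
End RegularFold.

Definition pad_step (char Q : Type) (tr : Q -> char -> Q) (q : Q)
    (o : option char) : Q := oapp (tr q) q o.

(** Padding leaves the state unchanged, so an automaton on pairs can also check that each component
    lies in a given regular language. *)
Lemma foldl_convolution (char : finType) (Q : Type) (tr : Q -> char -> Q) q
    (u v : seq char) :
  foldl (fun q p => pad_step tr q p.1) q (convolution u v) = foldl tr q u /\
  foldl (fun q p => pad_step tr q p.2) q (convolution u v) = foldl tr q v.
Proof.
elim: u v q => [|s u IHu] [|t v] q //.
- rewrite convolution_consr /=; elim: v q t => [|t' v IHv] q t //.
  rewrite convolution_consr /=; have [IH1 _] := IHv q t; have [_ IH2] := IHv (tr q t) t'.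
  by rewrite IH1 IH2.
- rewrite convolution_consl /=; have [-> _] := IHu [::] (tr q s).
  by have [_ ->] := IHu [::] q.
- rewrite convolution_cons /=; have [-> _] := IHu v (tr q s).
  by have [_ ->] := IHu v (tr q t).
Qed.

(** * Cayley automatic representations *)

Section Representation.
Variables (G : groupType) (A : {fset G}).
Local Notation S := (symgen A).

Lemma symgenP (g : G) :
  g \in S -> exists2 a, a \in A & g = a \/ g = (a^-1)%g.
Proof.
rewrite in_fsetU => /orP [gA|/imfsetP [a aA ->]]; first by exists g => //; left.
by exists a => //; right.
Qed.

Lemma symgenV (g : G) : g \in S -> (g^-1)%g \in S.
Proof.
case/symgenP => a aA [->|->]; rewrite in_fsetU.
  by apply/orP; right; apply/imfsetP; exists a.
by rewrite invgK aA.
Qed.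

Lemma word_val_cat (u v : seq S) :
  word_val (u ++ v) = (word_val u * word_val v)%g.
Proof. by rewrite /word_val big_cat. Qed.

Lemma word_val_inv (u : seq S) :
  exists2 v : seq S, size v = size u & word_val v = (word_val u)^-1%g.
Proof.
elim: u => [|s u [v size_v val_v]].
  by exists [::] => //; rewrite /word_val !big_nil invg1.
exists (rcons v [` symgenV (valP s)]%fset); first by rewrite size_rcons size_v.
rewrite -cats1 word_val_cat val_v /word_val big_seq1 big_cons invgM //.
Qed.

Lemma cayley_walkP (g1 g2 : G) n :
  cayley_walk A g1 g2 n <->
  exists2 w : seq S, size w = n & g2 = (g1 * word_val w)%g.
Proof.
split.
  case=> p []; elim: p g1 n => [|g p IHp] g1 n /=.
    by move=> _ <- <-; exists [::] => //; rewrite /word_val big_nil mulg1.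
  case/andP => edge path_p last_p size_p.
  have [w size_w g2E] := IHp g (size p) path_p last_p erefl.
  exists ([` edge]%fset :: w); first by rewrite /= size_w.
  by rewrite g2E /word_val big_cons /= mulgA mulVKg.
case=> w; elim: w g1 n => [|s w IHw] g1 n /= size_w g2E.
  by exists [::]; split => //; rewrite g2E /word_val big_nil mulg1.
have [|p [path_p last_p size_p]] := IHw (g1 * val s)%g _ erefl.
  by rewrite g2E /word_val big_cons mulgA.
exists ((g1 * val s)%g :: p); split => /=.
- by rewrite /cayley_edge mulKg (valP s).
- by [].
- by rewrite size_p.
Qed.

Lemma cayley_dist_le (g : G) (w : seq S) :
  (cayley_dist A g (g * word_val w)%g <= size w)%N.
Proof.
have walk : cayley_walk A g (g * word_val w)%g (size w).
  by apply/cayley_walkP; exists w.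
rewrite /cayley_dist; case: pselect => // ex; case: ex_minnP => m _; apply.
exact/asboolP.
Qed.

Lemma cayley_dist_word (g1 g2 : G) : generates A ->
  exists2 w : seq S, size w = cayley_dist A g1 g2 &
                     word_val w = (g1^-1 * g2)%g.
Proof.
move=> genA; rewrite /cayley_dist; case: pselect => [ex|[]].
  case: ex_minnP => m /asboolP /cayley_walkP [w size_w ->] _.
  by exists w => //; rewrite mulKg.
have [w w_val] := genA (g1^-1 * g2)%g.
exists (size w); apply/asboolP/cayley_walkP; exists w => //.
by rewrite w_val mulVKg.
Qed.

(** Both properties come from the automata of the relations, with one constant because [S] is
    finite. The length bound is [regular_rel_size]; the pair [u'], [v'] completes the two prefixes
    of length [k] to short representatives of neighbours. *)
Lemma rep_synchronous (L : set (seq S)) (psi : seq S -> G) :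
  cayley_automatic_rep L psi -> exists C, forall (s : S) u v, L u -> L v ->
    psi v = (psi u * val s)%g ->
    (size v <= size u + C)%N /\
    forall k, exists u' v', [/\ L u', L v', psi v' = (psi u' * val s)%g,
      (maxn (size u') (size v') <= k + C)%N &
      take k u' = take k u /\ take k v' = take k v].
Proof.
case=> _ bijL rel.
have psi_inj u v : L u -> L v -> psi u = psi v -> u = v.
  move=> Lu Lv; case: bijL => _ + _; apply; exact/mem_set.
pose good (s : G) C := forall u v, L u -> L v ->
    psi v = (psi u * s)%g ->
    (size v <= size u + C)%N /\
    forall k, exists u' v', [/\ L u', L v', psi v' = (psi u' * s)%g,
      (maxn (size u') (size v') <= k + C)%N &
      take k u' = take k u /\ take k v' = take k v].
have good_le s C C' : (C <= C')%N -> good s C -> good s C'.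
  move=> CC' sC u v Lu Lv uv; have [size_v ex] := sC u v Lu Lv uv; split.
    by apply: leq_trans size_v _; rewrite leq_add2l.
  move=> k; have [u' [v' [? ? ? size_le ?]]] := ex k; exists u', v'; split => //.
  by apply: leq_trans size_le _; rewrite leq_add2l.
have good_A a : a \in A -> exists C, good a C /\ good (a^-1)%g C.
  move=> /rel; set E := [set w | _]%classic => regE.
  have EP u v : E (u, v) <-> [/\ L u, L v & psi v = (psi u * a)%g].
    split=> [[g [[Lu <-] [Lv ->]]] //|[Lu Lv uv]].
    by exists (psi u).
  have regE' : regular_rel [set w : seq S * seq S | E (w.2, w.1)]%classic.
    exact: regular_rel_swap.
  have [C1 HC1] := regular_rel_completion regE.
  have [|C2 HC2] := regular_rel_size regE.
    move=> u v v' /EP [_ Lv uv] /EP [_ Lv' uv'].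
    by apply: psi_inj => //; rewrite uv uv'.
  have [|C3 HC3] := regular_rel_size regE'.
    move=> u v v' /EP [Lv _ uv] /EP [Lv' _ uv'].
    by apply: psi_inj => //; apply: (mulIg a); rewrite -uv -uv'.
  have comp u v k : E (u, v) -> exists u' v',
      [/\ L u', L v', psi v' = (psi u' * a)%g,
       (maxn (size u') (size v') <= k + C1)%N &
       take k u' = take k u /\ take k v' = take k v].
    move=> Euv; have [k_le|k_gt] := leqP k (maxn (size u) (size v)).
      have [u' [v' [/EP [Lu' Lv' uv'] size_le eq_k]]] := HC1 _ _ _ Euv k_le.
      exists u', v'; split => //.
      by split; apply: eq_take_onth => j /eq_k [].
    (* Past the end of both words, the pair is its own completion. *)
    have /EP [Lu Lv uv] := Euv.
    by exists u, v; split => //; apply: leq_trans (ltnW k_gt) (leq_addr _ _).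
  exists (C1 + C2 + C3)%N; split.
    apply: (@good_le _ (maxn C1 C2)); first by lia.
    move=> u v Lu Lv uv; have Euv : E (u, v) by apply/EP.
    split=> [|k]; first by rewrite (leq_trans (HC2 _ _ Euv)) // leq_add2l leq_maxr.
    have [u' [v' [? ? ? size_le ?]]] := comp _ _ k Euv.
    by exists u', v'; split => //; rewrite (leq_trans size_le) // leq_add2l leq_maxl.
  (* For the inverse of [a], the two words exchange their roles, whence the swapped relation in the
     length bound. *)
  apply: (@good_le _ (maxn C1 C3)); first by lia.
  move=> u v Lu Lv uv.
  have Evu : E (v, u) by apply/EP; split => //; rewrite uv mulgVK.
  split=> [|k]; first by rewrite (leq_trans (HC3 u v Evu)) // leq_add2l leq_maxr.
  have [u' [v' [Lu' Lv' uv' size_le [? ?]]]] := comp _ _ k Evu.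
  exists v', u'; split => //; first by rewrite uv' mulgK.
  by rewrite maxnC (leq_trans size_le) // leq_add2l leq_maxl.
have good_S (s : S) : exists C, good (val s) C.
  have [a /good_A [C [Ca Cav]] [->|->]] := symgenP (valP s); by exists C.
have [f f_ok] := choice good_S.
exists (\max_s f s) => s; apply: good_le (f_ok s); exact: leq_bigmax.
Qed.
End Representation.

(** This characterises the maximum as a least upper bound in [nat]: the first half serves the upper
    bound on the deviation, the second half the lower bound. *)
Lemma deviation_dist (R : realType) (G : groupType) (A : {fset G})
    (L : set (seq (symgen A))) (psi : seq (symgen A) -> G) n :
  exists2 H : nat, deviation R L psi n = H%:R &
    (forall B : nat, (forall w, L w -> (size w <= n)%N ->
       (cayley_dist A (word_val w) (psi w) <= B)%N) -> (H <= B)%N) /\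
    (forall w, L w -> (size w <= n)%N ->
       (cayley_dist A (word_val w) (psi w) <= H)%N).
Proof.
eexists; first by []; split=> [B devB|w Lw w_le].
  apply/bigmax_leqP => k _; apply/bigmax_leqP => w /asboolP Lw.
  by apply: devB => //; rewrite size_tuple -ltnS.
have w_lt : (size w < n.+1)%N by [].
apply: leq_trans (leq_bigmax (Ordinal w_lt)) => /=.
have Lw' : `[< L (in_tuple w) >] by apply/asboolP.
exact: (@leq_bigmax_cond _ (fun w : (size w).-tuple _ => `[< L w >])
  (fun w => cayley_dist A (word_val w) (psi w)) (in_tuple w) Lw').
Qed.

(** * Coordinates and balls of the Heisenberg group *)

Section Coordinates.
Implicit Types g h k : heisenberg.

Definition heis (x y z : int) : heisenberg := Sub (heis_mx x y z) (heis_mxP x y z).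
Definition hx g : int := val g 0 1.
Definition hy g : int := val g 1 2%:R.
Definition hz g : int := val g 0 2%:R.

Lemma heis_eta g : heis (hx g) (hy g) (hz g) = g.
Proof. by case: g => M M_heis; apply: val_inj; rewrite /= -(eqP M_heis). Qed.

Lemma hx_heis x y z : hx (heis x y z) = x. Proof. by rewrite /hx mxE. Qed.
Lemma hy_heis x y z : hy (heis x y z) = y. Proof. by rewrite /hy mxE. Qed.
Lemma hz_heis x y z : hz (heis x y z) = z. Proof. by rewrite /hz mxE. Qed.

Lemma heisM x y z x' y' z' :
  (heis x y z * heis x' y' z')%g = heis (x + x') (y + y') (z + x * y' + z').
Proof. by apply: val_inj; rewrite /= heis_mxM. Qed.

Lemma heis1 : 1%g = heis 0 0 0.
Proof. by apply: val_inj; rewrite /= heis_mx1. Qed.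

Lemma hxM g h : hx (g * h)%g = hx g + hx h.
Proof. by rewrite -[g]heis_eta -[h]heis_eta heisM !hx_heis. Qed.

Lemma hyM g h : hy (g * h)%g = hy g + hy h.
Proof. by rewrite -[g]heis_eta -[h]heis_eta heisM !hy_heis. Qed.

Lemma hzM g h : hz (g * h)%g = hz g + hx g * hy h + hz h.
Proof.
by rewrite -[g]heis_eta -[h]heis_eta heisM !hz_heis !hx_heis !hy_heis.
Qed.

Lemma hx1 : hx 1%g = 0. Proof. by rewrite heis1 hx_heis. Qed.
Lemma hy1 : hy 1%g = 0. Proof. by rewrite heis1 hy_heis. Qed.
Lemma hz1 : hz 1%g = 0. Proof. by rewrite heis1 hz_heis. Qed.

Lemma hxV g : hx (g^-1)%g = - hx g.
Proof. by rewrite /hx mxE. Qed.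
Lemma hyV g : hy (g^-1)%g = - hy g.
Proof. by rewrite /hy mxE. Qed.
Lemma hzV g : hz (g^-1)%g = hx g * hy g - hz g.
Proof. by rewrite /hz mxE. Qed.

Lemma heis_ext g h : hx g = hx h -> hy g = hy h -> hz g = hz h -> g = h.
Proof. by move=> ex ey ez; rewrite -[g]heis_eta ex ey ez heis_eta. Qed.
End Coordinates.

Section Ball.
Implicit Types g h k : heisenberg.

(* The fourth condition bounds the last coordinate of the inverse. *)
Definition heis_ball (D : nat) g :=
  [/\ `|hx g| <= D%:Z, `|hy g| <= D%:Z, `|hz g| <= D%:Z ^+ 2 &
      `|hx g * hy g - hz g| <= D%:Z ^+ 2].

Lemma heis_ball1 D : heis_ball D 1%g.
Proof. by rewrite /heis_ball hx1 hy1 hz1 mul0r subr0 normr0 sqr_ge0. Qed.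

Lemma heis_ballV D g : heis_ball D g -> heis_ball D (g^-1)%g.
Proof.
rewrite /heis_ball hxV hyV hzV !normrN => -[? ? ? ?]; split => //.
by rewrite mulrNN opprB addrCA subrr addr0.
Qed.

(** The radii add because each cross term is at most [D * D'], and the square of [D + D'] leaves
    room for two of them. *)
Lemma heis_ballM D D' g h :
  heis_ball D g -> heis_ball D' h -> heis_ball (D + D') (g * h)%g.
Proof.
rewrite /heis_ball hxM hyM hzM => -[x y z w] [x' y' z' w'].
have xy' : `|hx g * hy h| <= D%:Z * D'%:Z by rewrite normrM ler_pM.
have x'y : `|hx h * hy g| <= D%:Z * D'%:Z by rewrite mulrC normrM ler_pM.
have -> : (D + D')%:Z ^+ 2 = D%:Z ^+ 2 + D'%:Z ^+ 2 + D%:Z * D'%:Z + D%:Z * D'%:Z.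
  by rewrite PoszD; ring.
have DD' : 0 <= D%:Z * D'%:Z by rewrite mulr_ge0.
split.
- by rewrite PoszD; lia.
- by rewrite PoszD; lia.
- by lia.
have -> : (hx g + hx h) * (hy g + hy h) - (hz g + hx g * hy h + hz h) =
    (hx g * hy g - hz g) + (hx h * hy h - hz h) + hx h * hy g by ring.
by lia.
Qed.

Lemma heis_ballW D D' g : (D <= D')%N -> heis_ball D g -> heis_ball D' g.
Proof.
move=> DD'; have -> : D' = (D + (D' - D))%N by lia.
by move=> gD; rewrite -[g]mulg1; apply: heis_ballM => //; apply: heis_ball1.
Qed.

Lemma heis_ball_ex g : exists D, heis_ball D g.
Proof.
exists (absz (hx g) + absz (hy g) + absz (hz g) + absz (hx g * hy g - hz g)%R)%N.
have sq (a b : int) : `|a| <= b -> 0 <= b -> `|a| <= b ^+ 2.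
  move=> ab b0; apply: le_trans ab _; rewrite expr2; nia.
by split; [lia | lia | apply: sq; lia | apply: sq; lia].
Qed.

(** Since radii add under products, a common radius for the finitely many letters gives one that is
    linear in the length. *)
Lemma heis_ball_word (A : {fset heisenberg}) :
  exists2 D, (0 < D)%N & forall w : seq (symgen A), heis_ball (D * size w) (word_val w).
Proof.
have [f f_ok] := choice (fun s : symgen A => heis_ball_ex (val s)).
exists (\max_s f s).+1 => // w; elim: w => [|s w IHw].
  by rewrite /word_val big_nil; exact: heis_ball1.
rewrite /word_val big_cons /= mulnS; apply: heis_ballM => //.
by apply: heis_ballW (f_ok s); apply: leqW; exact: leq_bigmax.
Qed.
End Ball.

(** * The Engel cocycle and the lower bound *)

Section Cocycle.
Implicit Types (g h l : heisenberg) (u v w : seq heisenberg).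

(* The 2-cocycle of the Engel group, the central extension of the Heisenberg
   group in which [x, [x, y]] is central of infinite order. *)
Definition engel g h : int := 2 * (hx g * hz h) + hx g ^+ 2 * hy h.

Lemma engel_cocycle g h l :
  engel g h + engel (g * h)%g l = engel h l + engel g (h * l)%g.
Proof. by rewrite /engel !(hxM, hyM, hzM); ring. Qed.

Lemma engel1r g : engel g 1%g = 0.
Proof. by rewrite /engel hy1 hz1 !mulr0 addr0. Qed.

Lemma engel1l g : engel 1%g g = 0.
Proof. by rewrite /engel hx1 !mul0r mulr0 addr0. Qed.

(** With weight 1 for [hx] and [hy] and weight 2 for [hz], the cocycle is homogeneous of weight
    3. *)
Lemma engel_ball D g h :
  heis_ball D g -> heis_ball D h -> `|engel g h| <= 3 * D%:Z ^+ 3.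
Proof.
case=> gx _ _ _ [_ hy_le hz_le _].
have a : `|hx g * hz h| <= D%:Z * D%:Z ^+ 2 by rewrite normrM ler_pM.
have b : `|hx g ^+ 2 * hy h| <= D%:Z ^+ 2 * D%:Z.
  by rewrite normrM normrX ler_pM // ?exprn_ge0 // lerXn2r.
rewrite /engel; have -> : 3 * D%:Z ^+ 3 = 2 * (D%:Z * D%:Z ^+ 2) + D%:Z ^+ 2 * D%:Z by ring.
by move: (D%:Z * _) (D%:Z ^+ 2 * _) (hx g * _) (hx g ^+ 2 * _) a b => *; lia.
Qed.

Definition path_val w : heisenberg := (\prod_(g <- w) g)%g.

(* The central coordinate of the product of the letters of [w] in the Engel
   group, each letter being lifted with central coordinate [0]. *)
Fixpoint engel_lift w : int :=
  if w is g :: w' then engel_lift w' + engel g (path_val w') else 0.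

Lemma path_val_cat u v : path_val (u ++ v) = (path_val u * path_val v)%g.
Proof. by rewrite /path_val big_cat. Qed.

Lemma engel_lift_cat u v :
  engel_lift (u ++ v) =
  engel_lift u + engel_lift v + engel (path_val u) (path_val v).
Proof.
elim: u => [|g u IHu] /=; first by rewrite /path_val big_nil engel1l add0r addr0.
have -> : path_val (g :: u) = (g * path_val u)%g by rewrite /path_val big_cons.
have := engel_cocycle g (path_val u) (path_val v).
by rewrite IHu path_val_cat; lia.
Qed.

Definition path_disp u v : heisenberg := ((path_val u)^-1 * path_val v)%g.

(* In the Engel group, the lift of [u] times the lift of [path_disp u v] with
   central coordinate [0] differs from the lift of [v] by this central amount. *)
Definition engel_gap u v : int :=
  engel_lift u + engel (path_val u) (path_disp u v) - engel_lift v.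

(** This is the cocycle identity for [path_val u] and the two successive displacements. *)
Lemma engel_gapD u v w :
  engel_gap u v + engel_gap v w =
  engel_gap u w + engel (path_disp u v) (path_disp v w).
Proof.
have uv : (path_val u * path_disp u v)%g = path_val v by rewrite mulVKg.
have uvw : (path_disp u v * path_disp v w)%g = path_disp u w.
  by rewrite /path_disp -mulgA mulVKg.
have := engel_cocycle (path_val u) (path_disp u v) (path_disp v w).
by rewrite uv uvw /engel_gap; lia.
Qed.

Lemma path_disp_take k w :
  path_disp (take k w) (take k.+1 w) = nth 1%g w k.
Proof.
rewrite /path_disp; have [k_lt|k_ge] := ltnP k (size w).
  by rewrite (take_nth 1%g) // -cats1 path_val_cat mulKg /path_val big_seq1.
by rewrite !take_oversize ?(leqW k_ge) // nth_default // mulVg.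
Qed.

(** Appending a letter multiplies by its lift with central coordinate 0, so the sides of a square
    that run along a word contribute nothing. *)
Lemma engel_gap_take k w : engel_gap (take k w) (take k.+1 w) = 0.
Proof.
rewrite /engel_gap path_disp_take; have [k_lt|k_ge] := ltnP k (size w).
  rewrite [in X in _ - X](take_nth 1%g) // -cats1 engel_lift_cat /=.
  by rewrite /path_val big_nil big_seq1 engel1r; lia.
by rewrite !take_oversize ?(leqW k_ge) // nth_default // engel1r; lia.
Qed.

(** Either way round the square equals [engel_gap u v'] plus one value of the cocycle, and
    [engel_ball] bounds each of the two values. *)
Lemma engel_gap_square D u v u' v' :
  heis_ball D (path_disp u u') -> heis_ball D (path_disp v v') ->
  heis_ball D (path_disp u v) -> heis_ball D (path_disp u' v') ->
  `|(engel_gap u v + engel_gap v v') - (engel_gap u u' + engel_gap u' v')|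
    <= 6 * D%:Z ^+ 3.
Proof.
move=> uu' vv' uv u'v'.
have := engel_gapD u v v'; have := engel_gapD u u' v'.
have := engel_ball uv vv'; have := engel_ball uu' u'v'.
by move: (D%:Z ^+ 3) => *; lia.
Qed.

(** The strip between two words is cut into [k] squares whose sides along the words are single
    letters. *)
Lemma engel_gap_column D u v k :
  (forall j, heis_ball D (nth 1%g u j)) ->
  (forall j, heis_ball D (nth 1%g v j)) ->
  (forall j, heis_ball D (path_disp (take j u) (take j v))) ->
  `|engel_gap (take k u) (take k v)| <= k%:Z * (6 * D%:Z ^+ 3).
Proof.
move=> uD vD uvD; elim: k => [|k IHk].
  rewrite !take0 /engel_gap /path_disp mulVg engel1r; lia.
have := @engel_gap_square D (take k u) (take k v) (take k.+1 u) (take k.+1 v).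
rewrite !path_disp_take !engel_gap_take => /(_ (uD k) (vD k) (uvD k) (uvD k.+1)).
have -> : k.+1%:Z * (6 * D%:Z ^+ 3) = k%:Z * (6 * D%:Z ^+ 3) + 6 * D%:Z ^+ 3.
  by rewrite -addn1 PoszD mulrDl mul1r.
move: IHk; move: (6 * D%:Z ^+ 3) (k%:Z * _) => *; lia.
Qed.

(** Here the columns are assembled. The words [u i] lead to points near the vertices of the loop
    [w], and one more square per edge joins them to the prefixes of [w]. *)
Lemma engel_lift_loop D (B : int) (w : seq heisenberg) (u : nat -> seq heisenberg) :
  path_val w = 1%g -> u (size w) = u 0%N ->
  (forall j, heis_ball D (nth 1%g w j)) ->
  (forall i, (i < size w)%N -> heis_ball D (path_disp (u i) (u i.+1))) ->
  (forall i, (i <= size w)%N -> heis_ball D (path_disp (u i) (take i w))) ->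
  (forall i, (i < size w)%N -> `|engel_gap (u i) (u i.+1)| <= B) ->
  `|engel_lift w| <= (size w)%:Z * (B + 6 * D%:Z ^+ 3).
Proof.
move=> w1 u_end wD uD uwD uB.
have row i : (i <= size w)%N ->
    `|engel_gap (u i) (take i w) - engel_gap (u 0%N) [::]|
      <= i%:Z * (B + 6 * D%:Z ^+ 3).
  elim: i => [|i IHi] i_lt; first by rewrite take0 subrr normr0 mul0r.
  have := @engel_gap_square D (u i) (take i w) (u i.+1) (take i.+1 w).
  rewrite !path_disp_take !engel_gap_take.
  move=> /(_ (uD i i_lt) (wD i) (uwD i (ltnW i_lt)) (uwD i.+1 i_lt)).
  have -> : i.+1%:Z * (B + 6 * D%:Z ^+ 3) =
      i%:Z * (B + 6 * D%:Z ^+ 3) + B + 6 * D%:Z ^+ 3.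
    by rewrite -addn1 PoszD; ring.
  have := IHi (ltnW i_lt); have := uB i i_lt.
  move: (6 * D%:Z ^+ 3) (i%:Z * _) => *; lia.
(* Both gaps now start from [u 0] with the same displacement, because [path_val w = 1]; their
   difference is [- engel_lift w]. *)
have := row (size w) (leqnn _).
rewrite take_size u_end /engel_gap /path_disp w1 /path_val big_nil /=.
by move: (_ * _) => *; lia.
Qed.
End Cocycle.

Lemma take_rcons (T : Type) (w : seq T) i : (i < size w)%N ->
  exists s, take i.+1 w = rcons (take i w) s.
Proof. by case: w => // s w i_lt; exists (nth s (s :: w) i); rewrite -take_nth. Qed.

(** * Filling a loop of cubic Engel integral *)

Section LowerBound.
Variable A : {fset heisenberg}.
Local Notation S := (symgen A).

(** When [p * q = 0], the cocycle vanishes between powers of the same element, so the lift is linear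
    in [n]. *)
Lemma path_val_power (w : seq heisenberg) (p q : int) n :
  path_val w = heis p q 0 -> p * q = 0 ->
  path_val (flatten (nseq n w)) = heis (n%:Z * p) (n%:Z * q) 0 /\
  engel_lift (flatten (nseq n w)) = n%:Z * engel_lift w.
Proof.
move=> w_val pq0; elim: n => [|n [IHval IHlift]] /=.
  by rewrite /path_val big_nil heis1 !mul0r.
rewrite path_val_cat engel_lift_cat IHval IHlift w_val heisM.
split.
  by congr heis; rewrite ?intS; [ring | ring | rewrite add0r addr0 mulrCA pq0 mulr0].
rewrite /engel !hx_heis !hy_heis hz_heis intS.
have -> : p ^+ 2 * (n%:Z * q) = n%:Z * p * (p * q) by ring.
by rewrite pq0; ring.
Qed.

Lemma path_val_word (w : seq S) : path_val (map val w) = word_val w.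
Proof. by rewrite /path_val big_map. Qed.

(* The word is Y^n X^n Y^(-2n) X^n Y^n X^(-2n): the coefficients 1, -2, 1 of the
   powers of Y kill affine functions of the abscissa, hence the loop closes up,
   but not its square, which the cocycle integrates. *)
Lemma engel_cubic_loop : generates A -> exists (l : nat) (c : int), forall n,
  exists w : seq S, [/\ (size w <= l * n)%N, word_val w = 1%g &
    engel_lift (map val w) = 2 * n%:Z ^+ 3 + c * n%:Z].
Proof.
move=> genA.
have [X HX] := genA (heis 1 0 0); have [X' HX'] := genA (heis (-1) 0 0).
have [Y HY] := genA (heis 0 1 0); have [Y' HY'] := genA (heis 0 (-1) 0).
(* Each of the four words is used in two blocks of [n] copies. Their own lifts give the linear term,
   and the cocycle between blocks gives the cubic one. *)
exists (2 * (size X + size X' + size Y + size Y'))%N.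
exists (2 * (engel_lift (map val X) + engel_lift (map val X') +
             engel_lift (map val Y) + engel_lift (map val Y'))) => n.
pose P (w : seq S) := flatten (nseq n w).
have size_P w : size (P w) = (n * size w)%N.
  by rewrite /P size_flatten /shape map_nseq sumn_nseq mulnC.
have map_P w : map val (P w) = flatten (nseq n (map val w)).
  by rewrite /P map_flatten map_nseq.
exists (P Y ++ P X ++ P Y' ++ P Y' ++ P X ++ P Y ++ P X' ++ P X').
rewrite -path_val_word !map_cat !map_P !size_cat !size_P.
rewrite -!path_val_word in HX HX' HY HY'.
have [vX lX] := path_val_power n HX (mulr0 _).
have [vX' lX'] := path_val_power n HX' (mulr0 _).
have [vY lY] := path_val_power n HY (mul0r _).
have [vY' lY'] := path_val_power n HY' (mul0r _).
rewrite !(engel_lift_cat, path_val_cat) vX vX' vY vY' lX lX' lY lY'.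
rewrite /engel !heisM !(hx_heis, hy_heis, hz_heis) heis1; split.
- by lia.
- by congr heis; ring.
- by ring.
Qed.

(** Filling the cubic loop bounds [n ^ 3] by [P * D ^ 3 * n ^ 2], where [D] is affine in [H];
    dividing by [n ^ 2] leaves [n <= P * D ^ 3]. *)
Lemma heis_rep_lower_bound (L : set (seq S)) (psi : seq S -> heisenberg) :
  generates A -> cayley_automatic_rep L psi ->
  exists K M N : nat, [/\ (0 < K)%N, (0 < M)%N, (0 < N)%N & forall n H, (N <= n)%N ->
    (forall w, L w -> (size w <= M * n)%N ->
       (cayley_dist A (word_val w) (psi w) <= H)%N) ->
    (n <= (K * H) ^ 3)%N].
Proof.
move=> genA repL; have [r r_gt0 ballr] := heis_ball_word A.
have [C sync] := rep_synchronous repL.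
have [l [c loop]] := engel_cubic_loop genA.
have ex_f (g : heisenberg) : exists u, L u /\ psi u = g.
  by case: repL => _ [_ _ surj] _; have [u Lu <-] := surj g I; exists u.
have [f f_ok] := choice ex_f.
pose l0 := size (f 1%g).
pose P := (6 * l * (l0 + l * C + 1))%N.
(* The first constant absorbs [P] and [D] into a cube when [H > 0]. The second makes [M * n] bound
   the length of every word used. The third excludes [H = 0] and makes [n] exceed the absolute value
   of [c]. *)
exists ((P + 1) * (r * (2 * C + 3)))%N, (l0 + l * C + C + 1)%N.
exists (P * (r * (2 * C + 1)) ^ 3 + absz c + 1)%N; split; try by lia.
move=> n H N_le devH.
(* Two truncations of [C] letters, two deviations [H] and one generator, all scaled by [r]. Below,
   [K0] bounds the length of the representatives of the vertices of the loop. *)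
set D := (r * (2 * C + 2 * H + 1))%N.
pose K0 := (l0 + l * n * C)%N.
have n_gt0 : (0 < n)%N by lia.
have K0_le : (K0 + C <= (l0 + l * C + C + 1) * n)%N by rewrite /K0; nia.
have ball_letter (s : S) : heis_ball r (val s).
  by have := ballr [:: s]; rewrite /word_val big_seq1 muln1.
have ball_dev u : L u -> (size u <= K0 + C)%N ->
    heis_ball (r * H) ((word_val u)^-1 * psi u)%g.
  move=> Lu size_u; have [w size_w <-] := cayley_dist_word (word_val u) (psi u) genA.
  apply: heis_ballW (ballr w); rewrite leq_mul2l size_w devH ?orbT //.
  exact: leq_trans K0_le.
have ball_trunc k (u : seq S) : (size u <= k + C)%N ->
    heis_ball (r * C) ((word_val (take k u))^-1 * word_val u)%g.
  move=> size_u; rewrite -{2}(cat_take_drop k u) word_val_cat mulKg.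
  by apply: heis_ballW (ballr (drop k u)); rewrite leq_mul2l size_drop leq_subLR size_u orbT.
have fellow (s : S) u v k : L u -> L v -> psi v = (psi u * val s)%g ->
    (k <= K0)%N ->
    heis_ball D ((word_val (take k u))^-1 * word_val (take k v))%g.
  move=> Lu Lv uv k_le; have [_ /(_ k)] := sync s u v Lu Lv uv.
  case=> u' [v' [Lu' Lv' uv' size_le [<- <-]]].
  have [size_u' size_v'] : (size u' <= k + C)%N /\ (size v' <= k + C)%N.
    by move: size_le; rewrite geq_max => /andP.
  have kK : (k + C <= K0 + C)%N by rewrite leq_add2r.
  have -> : ((word_val (take k u'))^-1 * word_val (take k v') =
      (word_val (take k u'))^-1 * word_val u' * ((word_val u')^-1 * psi u') *
      val s * ((word_val v')^-1 * psi v')^-1 *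
      ((word_val (take k v'))^-1 * word_val v')^-1)%g.
    by rewrite uv' !invgM !invgK !mulgA !(mulgVK, mulgK).
  apply: (@heis_ballW (r * C + r * H + r + r * H + r * C)).
    by rewrite /D; nia.
  have := ball_trunc _ _ size_u'; have := ball_trunc _ _ size_v'.
  have := ball_dev _ Lu' (leq_trans size_u' kK).
  have := ball_dev _ Lv' (leq_trans size_v' kK).
  move=> /heis_ballV dv du /heis_ballV tv tu.
  by do 4!apply: heis_ballM => //.
have [w [size_w w1 lift_w]] := loop n.
pose u i := f (word_val (take i w)).
have u_step i : (i < size w)%N ->
    exists s : S, psi (u i.+1) = (psi (u i) * val s)%g.
  move=> /take_rcons [s take_w]; exists s; rewrite /u !(f_ok _).2 take_w.
  by rewrite -cats1 word_val_cat /word_val big_seq1.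
have size_u i : (i <= size w)%N -> (size (u i) <= l0 + i * C)%N.
  elim: i => [|i IHi] i_lt; first by rewrite /u take0 /word_val big_nil addn0.
  have [s us] := u_step i i_lt.
  have [size_le _] := sync s _ _ (f_ok _).1 (f_ok _).1 us.
  by apply: leq_trans size_le _; rewrite mulSn addnCA addnC leq_add2l IHi // ltnW.
have size_uK i : (i <= size w)%N -> (size (u i) <= K0)%N.
  move=> i_le; apply: leq_trans (size_u i i_le) _.
  by rewrite leq_add2l leq_mul2r (leq_trans i_le) ?orbT.
have ballD (s : S) : heis_ball D (val s).
  by apply: heis_ballW (ball_letter s); rewrite /D; nia.
have ball_nth (v : seq S) j : heis_ball D (nth 1%g (map val v) j).
  have [j_lt|j_ge] := ltnP j (size v); last first.
    by rewrite nth_default ?size_map //; exact: heis_ball1.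
  case: v j_lt => // s v j_lt; rewrite (nth_map s) //; exact: ballD.
have disp_u i j : (i < size w)%N ->
    heis_ball D (path_disp (take j (map val (u i))) (take j (map val (u i.+1)))).
  move=> i_lt; rewrite /path_disp -!map_take !path_val_word.
  have [s us] := u_step i i_lt.
  (* Beyond [K0] both prefixes are the whole words, which reduces to [j = K0]. *)
  have [j_le|j_gt] := leqP j K0; first exact: fellow (f_ok _).1 (f_ok _).1 us j_le.
  have take_u i' : (i' <= size w)%N -> take j (u i') = take K0 (u i').
    move=> /size_uK u_le; rewrite !take_oversize //.
    exact: leq_trans u_le (ltnW j_gt).
  rewrite !take_u //; last exact: ltnW.
  exact: fellow (f_ok _).1 (f_ok _).1 us (leqnn _).
have := @engel_lift_loop D (K0%:Z * (6 * D%:Z ^+ 3)) (map val w) (fun i => map val (u i)).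
rewrite size_map path_val_word w1 lift_w => /(_ erefl).
rewrite {1}/u take_size w1 {1}/u take0 {1}/word_val big_nil.
move=> /(_ erefl (ball_nth w)) bound.
have {}bound : `|2 * n%:Z ^+ 3 + c * n%:Z| <=
    (size w)%:Z * (K0%:Z * (6 * D%:Z ^+ 3) + 6 * D%:Z ^+ 3).
  apply: bound => i i_lt.
  - have := disp_u i K0 i_lt.
    by rewrite !take_oversize ?size_map ?size_uK // ltnW.
  - rewrite /path_disp -map_take !path_val_word -(f_ok (word_val (take i w))).2.
    apply: heis_ballW (ball_dev _ (f_ok _).1 _); first by rewrite /D; nia.
    by apply: leq_trans (size_uK i i_lt) (leq_addr _ _).
  - have := @engel_gap_column D (map val (u i)) (map val (u i.+1)) K0
      (ball_nth _) (ball_nth _) (fun j => disp_u i j i_lt).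
    by rewrite !take_oversize ?size_map ?size_uK // ltnW.
have n_le : (n <= P * D ^ 3)%N.
  (* As [c >= - n], the linear term is at least minus [n ^ 2], hence at least minus [n ^ 3]. *)
  have cube : n%:Z ^+ 3 <= `|2 * n%:Z ^+ 3 + c * n%:Z|.
    apply: le_trans (ler_norm _).
    have c_ge : - n%:Z <= c by lia.
    have cn_ge : - n%:Z * n%:Z <= c * n%:Z by rewrite ler_wpM2r.
    have : n%:Z * n%:Z <= n%:Z ^+ 3.
      by rewrite !exprS expr0 mulr1 ler_wpM2l // ler_peMl //; lia.
    by move: cn_ge; rewrite mulNr; lia.
  have {cube}bound : (n ^ 3 <= size w * ((K0 + 1) * (6 * D ^ 3)))%N.
    rewrite -lez_nat -(natz (n ^ 3)) natrX natz.
    apply: le_trans (le_trans cube bound) _.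
    suff -> : (size w * ((K0 + 1) * (6 * D ^ 3)))%N%:Z =
      (size w)%:Z * (K0%:Z * (6 * D%:Z ^+ 3) + 6 * D%:Z ^+ 3) by [].
    ring.
  have n2_gt0 : (0 < n ^ 2)%N by rewrite expn_gt0 n_gt0.
  rewrite -(leq_pmul2r n2_gt0) -expnS; apply: leq_trans bound _.
  have K0_le' : (K0 + 1 <= (l0 + l * C + 1) * n)%N by rewrite /K0; nia.
  have -> : (P * D ^ 3 * n ^ 2 = l * n * ((l0 + l * C + 1) * n * (6 * D ^ 3)))%N.
    by rewrite /P; ring.
  by rewrite leq_mul // leq_mul.
(* For [H = 0], [D] is the constant [r * (2 * C + 1)], and [n_le] contradicts the choice of the
   third constant. *)
have [H0|H_gt0] := posnP H.
  by move: n_le; rewrite /D H0 muln0 addn0; lia.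
have D_le : (D <= r * (2 * C + 3) * H)%N by rewrite /D; nia.
apply: leq_trans n_le _; rewrite -mulnA expnMn leq_mul //.
  by apply: (leq_trans (leq_addr 1 P)); rewrite -{1}[(P + 1)%N]expn1 leq_pexp2l // addn1.
by rewrite leq_exp2r.
Qed.
End LowerBound.

(** * The balanced ternary representation *)

Section BalancedTernary.

Definition cube_digits : seq int := [:: -1; 0; 1].

(** A letter of the cube carries one digit of each coordinate. The cube is not closed under
    inverses: the inverse of [heis 1 1 (-1)] has last coordinate 2. Hence normal words are
    explicitly required to have letters in [cube]. *)
Definition cube : {fset heisenberg} :=
  seq_fset tt [seq heis xy.1 xy.2 z | xy <- [seq (x, y) | x <- cube_digits, y <- cube_digits],
                                      z <- cube_digits].

Lemma cubeP g : reflect [/\ `|hx g| <= 1, `|hy g| <= 1 & `|hz g| <= 1] (g \in cube).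
Proof.
have digitP (x : int) : (x \in cube_digits) = (`|x| <= 1).
  by rewrite !inE; apply/idP/idP; lia.
rewrite seq_fsetE; apply: (iffP allpairsP) => [[[xy z] []]|[gx gy gz]].
  case/allpairsP => -[x y] [x_in y_in ->] z_in ->.
  by rewrite hx_heis hy_heis hz_heis -!digitP.
exists ((hx g, hy g), hz g); split; last by rewrite heis_eta.
  by apply/allpairsP; exists (hx g, hy g); rewrite !digitP.
by rewrite digitP.
Qed.

Lemma cube1 : 1%g \in cube.
Proof. by apply/cubeP; rewrite hx1 hy1 hz1. Qed.

Local Notation S := (symgen cube).
Implicit Types (s : S) (u v w : seq S).

Lemma cube_symgen g : g \in cube -> g \in S.
Proof. by move=> g_cube; rewrite in_fsetU g_cube. Qed.

Definition cube_letter g (g_cube : g \in cube) : S := [` cube_symgen g_cube]%fset.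

Lemma word_val_nseq s (p q r : int) n : val s = heis p q r -> p * q = 0 ->
  word_val (nseq n s) = heis (n%:Z * p) (n%:Z * q) (n%:Z * r).
Proof.
move=> sE pq0; elim: n => [|n IHn]; first by rewrite /word_val big_nil heis1 !mul0r.
rewrite /word_val big_cons -/(word_val _) IHn sE heisM.
congr heis; rewrite intS; [ring | ring |].
by rewrite mulrCA pq0; ring.
Qed.

Lemma cube_word g :
  exists2 w : seq S, word_val w = g & size w = (`|hx g| + `|hy g| + `|hz g|)%N.
Proof.
have letter (p q r : int) : `|p| <= 1 -> `|q| <= 1 -> `|r| <= 1 ->
    exists s : S, val s = heis p q r.
  move=> p1 q1 r1; have pqr : heis p q r \in cube.
    by apply/cubeP; rewrite hx_heis hy_heis hz_heis.
  by exists (cube_letter pqr).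
have sgz_le (x : int) : `|sgz x| <= 1 by case: sgzP.
have [sx sxE] := letter (sgz (hx g)) 0 0 (sgz_le _) isT isT.
have [sy syE] := letter 0 (sgz (hy g)) 0 isT (sgz_le _) isT.
have [sz szE] := letter 0 0 (sgz (hz g)) isT isT (sgz_le _).
(* Placing the powers of [sy] before those of [sx] avoids any cross term in the last coordinate. *)
exists (nseq `|hy g| sy ++ nseq `|hx g| sx ++ nseq `|hz g| sz).
  rewrite !word_val_cat (word_val_nseq _ syE) ?mul0r //.
  rewrite (word_val_nseq _ sxE) ?mulr0 // (word_val_nseq _ szE) ?mul0r //.
  have abs_sgz (x : int) : `|x|%N%:Z * sgz x = x by rewrite abszE mulrC -intEsg.
  rewrite !heisM !abs_sgz -[RHS]heis_eta; congr heis; ring.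
by rewrite !size_cat !size_nseq; lia.
Qed.

Lemma cube_generates : generates cube.
Proof. by move=> g; have [w w_val _] := cube_word g; exists w. Qed.

(* The least significant digit comes first. *)
Fixpoint ternary (c : heisenberg -> int) w : int :=
  if w is s :: w' then c (val s) + 3 * ternary c w' else 0.

Definition ternary_val w : heisenberg :=
  heis (ternary hx w) (ternary hy w) (ternary hz w).

Lemma heis100_neq1 : heis 1 0 0 != 1%g.
Proof. by apply/eqP => /(congr1 hx); rewrite hx_heis hx1. Qed.

(* The default [heis 1 0 0] makes the empty word normal. *)
Definition ternary_normal w :=
  all (fun s => val s \in cube) w && (last (heis 1 0 0) (map val w) != 1%g).

Lemma ternary_normal_cons s w : ternary_normal (s :: w) =
  [&& val s \in cube, ternary_normal w & (w == [::]) ==> (val s != 1%g)].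
Proof.
rewrite /ternary_normal /=; case: w => [|t w] /=; last by rewrite andbT -!andbA.
by rewrite heis100_neq1 andbT.
Qed.

Definition normal_step (q : bool * bool) s : bool * bool :=
  (q.1 && (val s \in cube), val s != 1%g).

Lemma normal_run w b g : foldl normal_step (b, g != 1%g) w =
  (b && all (fun s => val s \in cube) w, last g (map val w) != 1%g).
Proof.
by elim: w b g => [|s w IHw] b g /=; rewrite ?andbT // /normal_step /= IHw andbA.
Qed.

Lemma ternary_normalE w :
  ternary_normal w = (foldl normal_step (true, true) w == (true, true)).
Proof.
have := normal_run w true (heis 1 0 0); rewrite heis100_neq1 /= => ->.
by rewrite /ternary_normal; case: all; case: (_ != _).
Qed.

Lemma ternary_normal_regular : regular [set w | ternary_normal w]%classic.
Proof.
exists (@DFA S _ (true, true) (pred1 (true, true)) normal_step).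
by apply/seteqP; split => w; rewrite /mkset /dfa_accept ternary_normalE.
Qed.

(** A balanced digit is determined by the residue modulo 3, and a nontrivial last letter excludes
    final zeros, so only the empty word represents the identity. *)
Lemma ternary_val_inj u v : ternary_normal u -> ternary_normal v ->
  ternary_val u = ternary_val v -> u = v.
Proof.
have coord (u' v' : seq S) : ternary_val u' = ternary_val v' ->
    [/\ ternary hx u' = ternary hx v', ternary hy u' = ternary hy v' &
        ternary hz u' = ternary hz v'].
  move=> uv; split.
  - by have := congr1 hx uv; rewrite !hx_heis.
  - by have := congr1 hy uv; rewrite !hy_heis.
  - by have := congr1 hz uv; rewrite !hz_heis.
have nil (w : seq S) : ternary_normal w -> ternary_val w = ternary_val [::] -> w = [::].
  elim: w => // s w IHw; rewrite ternary_normal_cons.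
  case/and3P => /cubeP /= [sx sy sz] w_normal sN1 /coord [/= ex ey ez].
  have w0 : w = [::].
    apply: IHw => //; rewrite /ternary_val; congr heis => /=; lia.
  move: sN1; rewrite w0 /= => /eqP []; apply: heis_ext;
    rewrite ?hx1 ?hy1 ?hz1 /=; rewrite w0 /= in ex ey ez; lia.
elim: u v => [|s u IHu] [|t v].
- by [].
- by move=> _ nv /esym uv; rewrite (nil _ nv uv).
- by move=> nu _ uv; rewrite (nil _ nu uv).
rewrite !ternary_normal_cons.
case/and3P => /cubeP /= [sx sy sz] nu _ /and3P [/cubeP /= [tx ty tz] nv _].
move=> /coord [/= ex ey ez].
have -> : s = t by apply: val_inj; apply: heis_ext => /=; lia.
congr (_ :: _); apply: IHu => //; rewrite /ternary_val; congr heis => /=; lia.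
Qed.

Lemma ternary_val_surj g : exists2 w : seq S, ternary_normal w & ternary_val w = g.
Proof.
have digit (x : int) : exists d q : int,
    [/\ x = d + 3 * q, `|d| <= 1 & (`|q| + (x != 0) <= `|x|)%N].
  (* Rounding [x / 3] to the nearest integer leaves a balanced digit and strictly decreases the
     absolute value of a nonzero [x], which makes the induction terminate. *)
  exists (x - 3 * ((x + 1) %/ 3)%Z), ((x + 1) %/ 3)%Z; split; lia.
have [n] := ubnP (`|hx g| + `|hy g| + `|hz g|)%N.
elim: n g => // n IHn g g_lt.
have [g0|gN0] := eqVneq g (heis 0 0 0).
  exists [::]; last by rewrite g0.
  by rewrite /ternary_normal /= heis100_neq1.
have [dx [qx [xE dx1 qx_le]]] := digit (hx g).
have [dy [qy [yE dy1 qy_le]]] := digit (hy g).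
have [dz [qz [zE dz1 qz_le]]] := digit (hz g).
have gN : [|| hx g != 0, hy g != 0 | hz g != 0].
  apply: contraNT gN0; rewrite !negb_or !negbK => /and3P [/eqP x0 /eqP y0 /eqP z0].
  by rewrite -[g]heis_eta x0 y0 z0.
have [|w w_normal w_val] := IHn (heis qx qy qz).
  by rewrite hx_heis hy_heis hz_heis; move: gN; lia.
have d_cube : heis dx dy dz \in cube.
  by apply/cubeP; rewrite hx_heis hy_heis hz_heis.
have wx : ternary hx w = qx by rewrite -(hx_heis qx qy qz) -w_val hx_heis.
have wy : ternary hy w = qy by rewrite -(hy_heis qx qy qz) -w_val hy_heis.
have wz : ternary hz w = qz by rewrite -(hz_heis qx qy qz) -w_val hz_heis.
exists (cube_letter d_cube :: w).
  rewrite ternary_normal_cons d_cube w_normal /=; apply/implyP => /eqP w0.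
  apply: contraNneq gN0 => d1.
  have [dx0 dy0 dz0] : [/\ dx = 0, dy = 0 & dz = 0].
    move: d1; rewrite heis1 => d1; split.
    - by have := congr1 hx d1; rewrite !hx_heis.
    - by have := congr1 hy d1; rewrite !hy_heis.
    - by have := congr1 hz d1; rewrite !hz_heis.
  rewrite w0 /= in wx wy wz.
  by rewrite -[g]heis_eta xE yE zE -wx -wy -wz dx0 dy0 dz0.
rewrite /ternary_val /= hx_heis hy_heis hz_heis wx wy wz -xE -yE -zE.
exact: heis_eta.
Qed.

(** The extreme case has all digits 1 and value [(3 ^ n - 1) / 2]; this sharp form passes through
    the induction. *)
Lemma ternary_le (c : heisenberg -> int) w :
  all (fun s => `|c (val s)| <= 1) w -> (2 * `|ternary c w| + 1 <= 3 ^ size w)%N.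
Proof.
elim: w => // s w IHw /= /andP [s1 /IHw w_le]; rewrite expnS.
by lia.
Qed.
End BalancedTernary.

(** * Multiplication by a generator with finitely many carries *)

Section CarryAutomaton.
Local Notation S := (symgen cube).
Variable a : heisenberg.
Hypothesis a_cube : a \in cube.

Definition digit_of (o : option S) : heisenberg := oapp val 1%g o.

(* [F] is the carry: the rest of the second word has to represent
   [(x, y, z + hy a * x) + F], where [(x, y, z)] is represented by the rest of
   the first word. Carries never leave the cube. *)
Definition carry_rel (F d e F' : heisenberg) : bool :=
  [&& hx e + 3 * hx F' == hx d + hx F, hy e + 3 * hy F' == hy d + hy F &
      hz e + 3 * hz F' == hz d + hy a * hx d + hz F].

(** [carry_rel] determines the coordinates of the next carry, so [pick] has at most one candidate;
    [None] is a rejecting sink. *)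
Definition carry_step (F : option cube) (p : option S * option S) : option cube :=
  if F is Some F0 then
    [pick F' : cube | carry_rel (val F0) (digit_of p.1) (digit_of p.2) (val F')]
  else None.

Fixpoint digits_value (c : heisenberg -> int) (ds : seq heisenberg) : int :=
  if ds is d :: ds' then c d + 3 * digits_value c ds' else 0.

Definition carry_final (F : option cube) : bool :=
  if F is Some F0 then val F0 == 1%g else false.

Lemma carry_run (F : cube) (ps : seq (option S * option S)) :
  all (fun p => (digit_of p.1 \in cube) && (digit_of p.2 \in cube)) ps ->
  let v1 c := digits_value c [seq digit_of p.1 | p <- ps] in
  let v2 c := digits_value c [seq digit_of p.2 | p <- ps] in
  carry_final (foldl carry_step (Some F) ps) <->
  [/\ v2 hx = v1 hx + hx (val F), v2 hy = v1 hy + hy (val F) &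
      v2 hz = v1 hz + hy a * v1 hx + hz (val F)].
Proof.
elim: ps F => [|p ps IHps] F /=.
  move=> _; split=> [/eqP ->|[Fx Fy Fz]]; first by rewrite hx1 hy1 hz1 mulr0.
  by apply/eqP/heis_ext; rewrite ?hx1 ?hy1 ?hz1; lia.
case/andP => /andP [/cubeP [dx dy dz] /cubeP [ex ey ez]] /IHps {}IHps.
have dead : foldl carry_step None ps = None by elim: {IHps} ps.
cbv zeta beta in IHps; move: IHps.
set d := digit_of p.1 in dx dy dz *; set e := digit_of p.2 in ex ey ez *.
set x1 := digits_value hx [seq digit_of p.1 | p <- ps].
set y1 := digits_value hy [seq digit_of p.1 | p <- ps].
set z1 := digits_value hz [seq digit_of p.1 | p <- ps].
set x2 := digits_value hx [seq digit_of p.2 | p <- ps].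
set y2 := digits_value hy [seq digit_of p.2 | p <- ps].
set z2 := digits_value hz [seq digit_of p.2 | p <- ps] => IHps.
have dist : hy a * (hx d + 3 * x1) = hy a * hx d + 3 * (hy a * x1) by ring.
rewrite dist; case: pickP => [F' /and3P [/eqP Fx /eqP Fy /eqP Fz]|noF].
  apply: (iff_trans (IHps F')); move: (hy a * x1) (hy a * hx d) Fz => ax ad Fz.
  rewrite /=; by split=> -[? ? ?]; split; lia.
rewrite dead.
split=> // -[eqx eqy eqz].
have [/cubeP /= [Fx Fy Fz] /cubeP [_ ay _]] := (valP F, a_cube).
have ad_le : `|hy a * hx d| <= 1.
  by rewrite normrM -[1]mulr1; apply: ler_pM.
(* If the equations hold, the next carry is forced to be this difference of the tails. Three times
   each coordinate is a sum of at most four terms of absolute value at most 1, so the coordinate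
   itself is at most 1 in absolute value. *)
have F'_cube : heis (x2 - x1) (y2 - y1) (z2 - z1 - hy a * x1) \in cube.
  apply/cubeP; rewrite hx_heis hy_heis hz_heis.
  by move: (hy a * x1) (hy a * hx d) ad_le eqz => ax ad ad_le eqz; split; lia.
have := noF [` F'_cube]%fset; rewrite /carry_rel /= hx_heis hy_heis hz_heis.
move/negP; case; apply/and3P; split; apply/eqP; [lia | lia |].
by move: (hy a * x1) (hy a * hx d) eqz => ax ad eqz; lia.
Qed.

Lemma digits_value_convolution (c : heisenberg -> int) (u v : seq S) :
  c 1%g = 0 ->
  digits_value c [seq digit_of p.1 | p <- convolution u v] = ternary c u /\
  digits_value c [seq digit_of p.2 | p <- convolution u v] = ternary c v.
Proof.
move=> c1; elim: u v => [|s u IHu] [|t v] //.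
- rewrite convolution_consr /= c1 add0r.
  elim: v t => [|t' v IHv] t; first by rewrite /= mulr0.
  by rewrite convolution_consr /= c1 add0r; have [-> ->] := IHv t'; rewrite mulr0.
- rewrite convolution_consl /= c1 add0r.
  by have [-> ->] := IHu [::]; rewrite mulr0.
- by rewrite convolution_cons /=; have [-> ->] := IHu v.
Qed.

Lemma digits_cube_convolution (u v : seq S) :
  all (fun p => (digit_of p.1 \in cube) && (digit_of p.2 \in cube)) (convolution u v) =
  all (fun s => val s \in cube) u && all (fun s => val s \in cube) v.
Proof.
elim: u v => [|s u IHu] [|t v] //.
- rewrite convolution_consr /= cube1; congr (_ && _).
  by elim: v => // t' v IHv; rewrite convolution_consr /= cube1 IHv.
- rewrite convolution_consl /= cube1 !andbT; congr (_ && _).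
  by rewrite IHu andbT.
- by rewrite convolution_cons /= IHu; do !case: (_ \in _) => //=; rewrite andbF.
Qed.
End CarryAutomaton.

Section TernaryRepresentation.
Local Notation S := (symgen cube).

(** Right multiplication by [a] adds the coordinates of [a] and the term [hy a * x] in the last one:
    the automaton adds this term digit by digit and takes [a] itself as initial carry. *)
Lemma ternary_valM a u v : a \in cube -> ternary_normal u -> ternary_normal v ->
  carry_final (foldl (carry_step a) [pick F : cube | val F == a] (convolution u v)) <->
  ternary_val v = (ternary_val u * a)%g.
Proof.
move=> a_cube /andP [nu _] /andP [nv _].
case: pickP => [F /eqP Fa|/(_ [` a_cube]%fset)]; last by rewrite eqxx.
have := @carry_run a a_cube F (convolution u v).
rewrite digits_cube_convolution nu nv => /(_ isT) /= runP.
have [x1 x2] := @digits_value_convolution hx u v hx1.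
have [y1 y2] := @digits_value_convolution hy u v hy1.
have [z1 z2] := @digits_value_convolution hz u v hz1.
rewrite x1 x2 y1 y2 z1 z2 [fsval F]Fa in runP.
apply: (iff_trans runP); split=> [[vx vy vz]|uv].
  rewrite /ternary_val vx vy vz -[in RHS](heis_eta a) heisM.
  by congr heis; ring.
split.
- by have := congr1 hx uv; rewrite hxM !hx_heis.
- by have := congr1 hy uv; rewrite hyM !hy_heis.
- by have := congr1 hz uv; rewrite hzM hx_heis !hz_heis mulrC.
Qed.

Lemma ternary_rep :
  cayley_automatic_rep [set w : seq S | ternary_normal w]%classic ternary_val.
Proof.
split; first exact: ternary_normal_regular.
  split=> //.
  - by move=> u v /set_mem nu /set_mem nv; apply: ternary_val_inj.
  - by move=> g _; have [w w_normal <-] := ternary_val_surj g; exists w.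
move=> a a_cube.
(* The carry automaton runs in parallel with a normality check on each component. *)
pose Q : finType := (option cube * (bool * bool) * (bool * bool))%type.
pose tr (q : Q) (p : option S * option S) : Q :=
  (carry_step a q.1.1 p, pad_step normal_step q.1.2 p.1,
   pad_step normal_step q.2 p.2).
pose q0 : Q := ([pick F : cube | val F == a], (true, true), (true, true)).
pose fin (q : Q) :=
  [&& carry_final q.1.1, q.1.2 == (true, true) & q.2 == (true, true)].
apply: (@regular_rel_fold S Q q0 fin tr) => u v.
have run ps q : foldl tr q ps =
    (foldl (carry_step a) q.1.1 ps,
     foldl (fun q p => pad_step normal_step q p.1) q.1.2 ps,
     foldl (fun q p => pad_step normal_step q p.2) q.2 ps).
  by elim: ps q => [|p ps IHps] q /=; [case: q => -[] | rewrite IHps].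
have [run1 _] := foldl_convolution normal_step (true, true) u v.
have [_ run2] := foldl_convolution normal_step (true, true) u v.
rewrite run /fin /q0 /= run1 run2 -!ternary_normalE.
split=> [[g [[nu <-] [nv uv]]]|/and3P [uv nu nv]].
  by apply/and3P; split=> //; apply/ternary_valM.
by exists (ternary_val u); do !split => //; apply/ternary_valM.
Qed.

(** Passing through the identity costs [size w] plus the absolute values of the three coordinates,
    and each of these four numbers is at most [3 ^ size w]. *)
Lemma ternary_dist_le (w : seq S) : ternary_normal w ->
  (cayley_dist cube (word_val w) (ternary_val w) <= 4 * 3 ^ size w)%N.
Proof.
case/andP => w_cube _.
have [u size_u val_u] := word_val_inv w.
have [v val_v size_v] := cube_word (ternary_val w).
have -> : ternary_val w = (word_val w * word_val (u ++ v))%g.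
  by rewrite word_val_cat val_u val_v mulVKg.
apply: leq_trans (cayley_dist_le _ _) _; rewrite size_cat size_u size_v.
rewrite hx_heis hy_heis hz_heis.
have coord_le (c : heisenberg -> int) :
    (forall g, g \in cube -> `|c g| <= 1) -> (`|ternary c w| <= 3 ^ size w)%N.
  move=> c_le; have : all (fun s : S => `|c (val s)| <= 1) w.
    by apply: sub_all w_cube => s /c_le.
  by move/ternary_le; lia.
have x_le : (`|ternary hx w| <= 3 ^ size w)%N by apply: coord_le => g /cubeP [].
have y_le : (`|ternary hy w| <= 3 ^ size w)%N by apply: coord_le => g /cubeP [].
have z_le : (`|ternary hz w| <= 3 ^ size w)%N by apply: coord_le => g /cubeP [].
have := ltn_expl (size w) (isT : (1 < 3)%N); lia.
Qed.
End TernaryRepresentation.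

Lemma heisenberg_exp (R : realType) : in_B (exp_growth R) heisenberg.
Proof.
split.
  exists cube; split; first exact: cube_generates.
  by exists [set w | ternary_normal w]%classic, ternary_val; exact: ternary_rep.
exists cube; split; first exact: cube_generates.
exists [set w | ternary_normal w]%classic, ternary_val; split; first exact: ternary_rep.
(* The factor 2 comes from [3 = 1 + 2 <= expR 2], which gives [4 * 3 ^ n <= 4 * expR (2 * n)]. The
   empty word is normal, so the deviation is defined at every positive [n]. *)
exists 4%N, 2%N, 1%N; split=> // [n n_gt0|n _].
  split=> //=; split=> //; exists [::] => //.
  by rewrite /ternary_normal /= heis100_neq1.
have [H -> [H_le _]] := deviation_dist R [set w | ternary_normal w]%classic ternary_val n.
have {}H_le : (H <= 4 * 3 ^ n)%N.
  apply: H_le => w w_normal w_le; apply: leq_trans (ternary_dist_le w_normal) _.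
  by rewrite leq_mul2l leq_pexp2l.
apply: (@le_trans _ _ (4 * 3 ^ n)%N%:R); first by rewrite ler_nat.
rewrite natrM natrX ler_wpM2l // [leRHS]/= natrM mulrC expRM_natl.
by rewrite lerXn2r ?nnegrE ?expR_ge0 //; apply: le_trans (expR_ge1Dx _); rewrite -natr1 addrC.
Qed.

Lemma heisenberg_cbrt (R : realType) (f : pfun_nat R) :
  in_B f heisenberg -> growth_le (cbrt_growth R) f.
Proof.
case=> _ [A [genA [L [psi [repL [K' [M' [N' [[K'_gt0 M'_gt0 N'_gt0] dom_le dev_le]]]]]]]]].
have [K [M [N [K_gt0 M_gt0 N_gt0 lower]]]] := heis_rep_lower_bound genA repL.
(* The lower bound at [n] concerns words of length at most [M * n]; the hypothesis on the deviation
   is therefore applied at [M * n], and the constants multiply. *)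
exists (K * K')%N, (M' * M)%N, (N + N')%N; split.
- by rewrite !muln_gt0 K_gt0 K'_gt0 M_gt0 M'_gt0 addn_gt0 N_gt0.
- move=> n /= n_ge; split; first by apply: leq_trans n_ge; rewrite addn_gt0 N_gt0.
  by have [|_ //] := dom_le n; apply: leq_trans n_ge; exact: leq_addl.
move=> n n_ge; have N_le : (N <= n)%N by apply: leq_trans n_ge; exact: leq_addr.
have N'_le : (N' <= M * n)%N.
  by apply: leq_trans (leq_trans _ n_ge) (leq_pmull _ M_gt0); exact: leq_addl.
have [H devE [_ devH]] := deviation_dist R L psi (M * n).
have := dev_le _ N'_le; rewrite devE mulnA => H_le.
have n_le := lower n H N_le devH.
rewrite natrM -mulrA; apply: (@le_trans _ _ (K%:R * H%:R)); last by rewrite ler_wpM2l.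
rewrite -natrM /=.
apply: (@le_trans _ _ (((K * H) ^ 3)%N%:R `^ 3%:R^-1)).
  by apply: ge0_ler_powR; rewrite ?invr_ge0 ?nnegrE ?ler0n ?ler_nat.
by rewrite natrX -powR_mulrn ?ler0n // -powRrM mulfV ?powRr1 ?ler0n // pnatr_eq0.
Qed.

Theorem theorem17 (R : realType) :
  in_B (exp_growth R) heisenberg /\
  (forall f : pfun_nat R, growth f -> growth_lt f (cbrt_growth R) ->
     ~ in_B f heisenberg).
Proof.
split=> [|f _ [f_le not_equiv] fB]; first exact: heisenberg_exp.
by apply: not_equiv; split=> //; exact: heisenberg_cbrt.
Qed.
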